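(* Let $n\ge1$ and $\sigma\in S_{2n}$. The map $\sigma(\cdot):\mathcal{D}_n\to\mathcal{D}_n$, $D\mapsto\sigma(D)$, is a bijection if and only if $\sigma$ is a circularly-connected permutation.
   Context: A Dyck path of size $n$ is a word in $\mathtt{u},\mathtt{d}$ with $n$ of each letter whose every prefix has at least as many $\mathtt{u}$'s as $\mathtt{d}$'s; $\mathcal{D}_n$ is their set. The tunneling $\tau_D\in S_{2n}$ of $D$ is the fixed-point-free involution pairing each up-step position with the position of its matching down-step. For $\sigma\in S_{2n}$, $\sigma_k=\sigma(k)$, $\sigma_{[k]}=\{\sigma_1,\dots,\sigma_k\}$; the $\sigma$-path $\sigma(D)$ is the word with $\sigma(D)_k=\mathtt{u}$ if $\tau_D(\sigma_k)\notin\sigma_{[k]}$ and $\mathtt{d}$ otherwise (it is always a Dyck path). Arithmetic on $[2n]$ is modulo $2n$; a block of size $k$ is a set $\{x,x+1,\dots,x+k-1\}$ (mod $2n$). $\sigma$ is a circularly-connected permutation (CCP) if $\sigma_{[k]}$ is a block of size $k$ for every $k\in[2n]$. *)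

(* Defs.v *)
From HB Require Import structures.
From mathcomp Require Import all_boot all_fingroup.
From mathcomp Require Import zify.

Set Implicit Arguments.
Unset Strict Implicit.
Unset Printing Implicit Defensive.

Notation up := true (only parsing).
Notation down := false (only parsing).

Definition is_dyck (n : nat) (w : seq bool) : bool :=
  [&& count_mem up w == n, count_mem down w == n &
      all (fun k => count_mem down (take k w) <= count_mem up (take k w))
          (iota 0 (size w).+1)].

Record dyck (n : nat) := Dyck {
  dyck_word :> (n.*2).-tuple bool;
  dyck_wordP : is_dyck n dyck_word
}.

HB.instance Definition _ n := [isSub for @dyck_word n].
HB.instance Definition _ n := [Finite of dyck n by <:].

(* w = A u B d C with B a Dyck path, the displayed u and d being at the
   (0-based) positions i and j. *)
Definition matching (w : seq bool) (i j : nat) : bool :=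
  let B := take (j - i.+1) (drop i.+1 w) in
  [&& i < j < size w, nth down w i == up, nth up w j == down &
      is_dyck (count_mem up B) B].

(* The default value i is never used on a Dyck path: see tunneling_spec. *)
Definition tunneling_fun (n : nat) (D : dyck n) (i : 'I_(n.*2)) : 'I_(n.*2) :=
  odflt i [pick j : 'I_(n.*2) | matching D i j || matching D j i].

Local Ltac gen_lia :=
  repeat match goal with |- context [count ?p ?s] =>
    let x := fresh in set x := (count p s); clearbody x end; lia.

Section Matching.

Implicit Types (w : seq bool) (i j k : nat).

Let a w k := count_mem up (take k w).
Let b w k := count_mem down (take k w).

Let a0 w : a w 0 = 0. Proof. by rewrite /a take0. Qed.
Let b0 w : b w 0 = 0. Proof. by rewrite /b take0. Qed.

Let aS w k : k < size w -> a w k.+1 = a w k + nth down w k.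
Proof.
by move=> kw; rewrite /a (take_nth down) // -cats1 count_cat /=; case: nth.
Qed.

Let bS w k : k < size w -> b w k.+1 = b w k + ~~ nth down w k.
Proof.
by move=> kw; rewrite /b (take_nth down) // -cats1 count_cat /=; case: nth.
Qed.

Let count_sub (c : bool) w i j k : i <= k -> k <= j ->
  count_mem c (take (k - i) (take (j - i) (drop i w)))
    + count_mem c (take i w) = count_mem c (take k w).
Proof.
move=> ik kj; rewrite take_takel; last by lia.
by rewrite addnC -count_cat -takeD subnKC.
Qed.

Let matchingE w i j : matching w i j <->
  [/\ i < j < size w, nth down w i, ~~ nth down w j,
      a w j + b w i.+1 = b w j + a w i.+1
    & forall k, i < k <= j -> b w k + a w i.+1 <= a w k + b w i.+1].
Proof.
rewrite /matching /is_dyck eqxx andTb eqb_id.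
have sB : i < j < size w ->
    size (take (j - i.+1) (drop i.+1 w)) = j - i.+1.
  by move=> ?; rewrite size_takel // size_drop; lia.
have nthE : j < size w -> (nth up w j == down) = ~~ nth down w j.
  by move=> jw; rewrite (set_nth_default down) //; case: nth.
have tB : i < j < size w -> take (j - i.+1) (take (j - i.+1) (drop i.+1 w))
    = take (j - i.+1) (drop i.+1 w).
  by move=> ?; rewrite take_oversize // sB.
split.
  case/and4P => ij wi wj /andP[/eqP cB /allP aB].
  have ij' : i < j by lia.
  split=> //; first by rewrite -nthE //; lia.
    have := count_sub up w ij' (leqnn j).
    have := count_sub down w ij' (leqnn j).
    rewrite !tB // cB /a /b; gen_lia.
  move=> k /andP[ik kj].
  have kin : k - i.+1 \in iota 0 (size (take (j - i.+1) (drop i.+1 w))).+1.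
    by rewrite mem_iota sB //; lia.
  have := aB _ kin.
  have := count_sub up w ik kj.
  have := count_sub down w ik kj.
  rewrite /a /b; gen_lia.
case=> ij wi wj cB aB.
have ij' : i < j by lia.
apply/and4P; split=> //; first by rewrite nthE //; lia.
apply/andP; split.
  apply/eqP.
  have := count_sub up w ij' (leqnn j).
  have := count_sub down w ij' (leqnn j).
  rewrite !tB //; move: cB; rewrite /a /b; gen_lia.
apply/allP => k; rewrite mem_iota sB // => kin.
have ik : i < k + i.+1 by lia.
have kj : k + i.+1 <= j by lia.
have := aB (k + i.+1); rewrite ik kj => /(_ isT).
have := count_sub up w ik kj.
have := count_sub down w ik kj.
rewrite addnK /a /b; gen_lia.
Qed.

Lemma matching_injr w i j j' : matching w i j -> matching w i j' -> j = j'.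
Proof.
wlog: j j' / j <= j' => [W|jj'] h h'.
  by case: (leqP j j') => [/W|/ltnW /W ->]; auto.
case/matchingE: h => ij wi wj e le; case/matchingE: h' => ij' _ wj' e' le'.
case: (eqVneq j j') => // nj; exfalso.
have jw : j < size w by lia.
have := le' j.+1; rewrite (aS jw) (bS jw) (negbTE wj) /=.
have -> : i < j.+1 <= j' by lia.
by move/(_ isT); lia.
Qed.

Lemma matching_injl w i i' j : matching w i j -> matching w i' j -> i = i'.
Proof.
wlog: i i' / i <= i' => [W|ii'] h h'.
  by case: (leqP i i') => [/W|/ltnW /W ->]; auto.
case/matchingE: h => ij wi wj e le; case/matchingE: h' => ij' wi' wj' e' le'.
case: (eqVneq i i') => // nj; exfalso.
have iw : i' < size w by lia.
move: e'; rewrite (aS iw) (bS iw) wi' /= => e'.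
have := le i'; have -> : i < i' <= j by lia.
by move/(_ isT); lia.
Qed.

Lemma matching_up w i j : matching w i j -> nth down w i.
Proof. by case/matchingE. Qed.

Lemma matching_down w i j : matching w i j -> ~~ nth down w j.
Proof. by case/matchingE. Qed.

Lemma matching_lt w i j : matching w i j -> i < j < size w.
Proof. by case/matchingE. Qed.

Lemma matching_uniq w i j j' :
  matching w i j || matching w j i ->
  matching w i j' || matching w j' i -> j = j'.
Proof.
case/orP=> h /orP[] h'; first exact: matching_injr h h'.
- by have := matching_down h'; rewrite (matching_up h).
- by have := matching_down h; rewrite (matching_up h').
exact: matching_injl h h'.
Qed.

Let is_dyckE n w : is_dyck n w -> a w (size w) = b w (size w) /\
  forall k, k <= size w -> b w k <= a w k.
Proof.
case/and3P => /eqP c1 /eqP c2 /allP c3; split.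
  by rewrite /a /b take_size c1 c2.
by move=> k kw; apply: c3; rewrite mem_iota.
Qed.

Lemma matching_ex_up n w i : is_dyck n w -> i < size w -> nth down w i ->
  exists j, matching w i j.
Proof.
move=> /is_dyckE [eqn le] iw wi.
pose P j := (i <= j < size w) && (a w j.+1 + b w i <= b w j.+1 + a w i).
have exP : exists j, P j.
  exists (size w).-1; rewrite /P prednK; last by lia.
  by have := le i (ltnW iw); lia.
have [j Pj minj] := ex_minnP exP.
have hk k : i < k <= j -> b w k + a w i.+1 <= a w k + b w i.+1.
  move=> ikj; case: (leqP (b w k + a w i.+1) (a w k + b w i.+1)) => // lt.
  have : P k.-1.
    rewrite /P prednK; last by lia.
    by have := aS iw; have := bS iw; rewrite wi /=; move: Pj; rewrite /P; lia.
  by move/minj; lia.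
move: (Pj); rewrite /P => /andP[ij hj].
have jw : j < size w by lia.
have aj := aS jw; have bj := bS jw.
have ai := aS iw; have bi := bS iw.
have nij : i != j.
  by apply/eqP=> eij; subst j; move: hj; rewrite ai bi wi /=; lia.
have hkj := hk j.
exists j; apply/matchingE; move: ai bi; rewrite wi /= => ai bi.
by case ej: (nth down w j) aj bj => /= aj bj; split => //; lia.
Qed.

Lemma matching_ex_down n w j : is_dyck n w -> j < size w -> ~~ nth down w j ->
  exists i, matching w i j.
Proof.
move=> /is_dyckE [eqn le] jw /negbTE wj.
pose P i := (i <= j) && (a w i + b w j.+1 <= b w i + a w j.+1).
have exP : exists i, P i.
  by exists 0; rewrite /P a0 b0; have := le j.+1 jw; lia.
have ubP i : P i -> i <= j by case/andP.
have [i Pi maxi] := ex_maxnP exP ubP.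
have aj := aS jw; have bj := bS jw; move: aj bj; rewrite wj /= => aj bj.
have hk k : i < k <= j -> b w k + a w j <= a w k + b w j.
  move=> ikj; case: (leqP (b w k + a w j) (a w k + b w j)) => // lt.
  have : P k by rewrite /P; lia.
  by move/maxi; lia.
move: (Pi); rewrite /P => /andP[ij hi].
have iw : i < size w by lia.
have ai := aS iw; have bi := bS iw.
have nij : i != j by apply/eqP=> eij; subst j; move: hi; lia.
have hi1 := hk i.+1.
exists i; apply/matchingE.
by case ei: (nth down w i) ai bi => /= ai bi; split => //;
  try lia; move=> k /hk; lia.
Qed.

End Matching.

Section Tunneling.

Variables (n : nat) (D : dyck n).

Lemma tunneling_spec (i : 'I_(n.*2)) :
  matching D i (tunneling_fun D i) || matching D (tunneling_fun D i) i.
Proof.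
rewrite /tunneling_fun; case: pickP => //= no.
have iw : i < size D by rewrite size_tuple.
case ei: (nth down D i).
  have [j mj] := matching_ex_up (dyck_wordP D) iw ei.
  have /andP[_] := matching_lt mj; rewrite size_tuple => jn.
  by have := no (Ordinal jn); rewrite /= mj.
have [j mj] := matching_ex_down (dyck_wordP D) iw (negbT ei).
have /andP[ji _] := matching_lt mj.
by have := no (Ordinal (ltn_trans ji (ltn_ord i))); rewrite /= mj orbT.
Qed.

Lemma tunneling_funK : involutive (tunneling_fun D).
Proof.
move=> i; apply/val_inj.
apply: (matching_uniq (tunneling_spec (tunneling_fun D i))).
by rewrite orbC; exact: tunneling_spec.
Qed.

Definition tunneling : 'S_(n.*2) := perm (inv_inj tunneling_funK).

Lemma tunnelingK : involutive tunneling.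
Proof. by move=> i; rewrite !permE tunneling_funK. Qed.

Lemma tunneling_neq i : tunneling i != i.
Proof.
rewrite permE; apply/eqP=> e; have := tunneling_spec i.
by rewrite e orbb => /matching_lt; rewrite ltnn.
Qed.

End Tunneling.

(* sigma_[k], the set of the first k values of s *)
Definition prefix_set (n : nat) (s : 'S_(n.*2)) (k : nat) : {set 'I_(n.*2)} :=
  [set s i | i : 'I_(n.*2) & i < k].

(* Positions are 0-based, so the letter at k is tested against sigma_[k+1]. *)
Definition sigma_word (n : nat) (s : 'S_(n.*2)) (D : dyck n) :
    (n.*2).-tuple bool :=
  [tuple tunneling D (s k) \notin prefix_set s k.+1 | k < n.*2].

Section SigmaDyck.

Variables (n : nat) (s : 'S_(n.*2)) (D : dyck n).

Let t := tunneling D.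
Let r (k : 'I_(n.*2)) : 'I_(n.*2) := (s^-1)%g (t (s k)).

Let rK : involutive r.
Proof. by move=> k; rewrite /r permKV tunnelingK permK. Qed.

Let rneq k : r k != k.
Proof.
apply/eqP=> e; have /eqP := tunneling_neq D (s k); apply.
by rewrite -{2}e /r permKV.
Qed.

Let sigma_wordE (k : 'I_(n.*2)) : tnth (sigma_word s D) k = (k < r k).
Proof.
rewrite tnth_mktuple ltnNge; congr (~~ _); rewrite -ltnS.
have -> : tunneling D (s k) = s (r k) by rewrite /r permKV.
by rewrite mem_imset ?inE //; exact: perm_inj.
Qed.

Let count_take (c : bool) m :
  count_mem c (take m (sigma_word s D)) =
  #|[set k : 'I_(n.*2) | (k < m) && ((k < r k) == c)]|.
Proof.
set w := sigma_word s D.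
rewrite -sum1_count -sum1_card.
rewrite (big_nth c) size_take size_tuple.
rewrite -/(minn m n.*2).
transitivity (\sum_(0 <= i < n.*2 | (i < m) && (nth c w i == c)) 1).
  rewrite (@big_nat_widen _ _ _ 0 (minn m n.*2) n.*2) ?geq_minr //.
  rewrite big_nat_cond [RHS]big_nat_cond; apply: eq_bigl => i.
  rewrite leq_min; case: (ltnP i n.*2) => //= _.
  case: (ltnP i m) => //= im; last by rewrite ?andbF.
  by rewrite nth_take // !andbT.
rewrite big_mkord; apply: eq_bigl => k; rewrite inE.
by rewrite -sigma_wordE (tnth_nth c).
Qed.

Lemma sigma_word_dyck : is_dyck n (sigma_word s D).
Proof.
set w := sigma_word s D.
have pre m : count_mem down (take m w) <= count_mem up (take m w).
  rewrite !count_take -(card_imset _ (inv_inj rK)); apply: subset_leq_card.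
  apply/subsetP=> x /imsetP[k]; rewrite !inE => /andP[km /eqP rk] ->.
  have := rneq k; rewrite rK -val_eqE /=; move/negbT: rk; rewrite -leqNgt.
  lia.
have suf : count_mem up w <= count_mem down w.
  rewrite -(take_size w) size_tuple !count_take.
  rewrite -(card_imset _ (inv_inj rK)); apply: subset_leq_card.
  apply/subsetP=> x /imsetP[k]; rewrite !inE => /andP[km /eqP rk] ->.
  by rewrite rK ltn_ord; lia.
have := pre (size w); rewrite take_size => pre'.
have tot : count_mem up w + count_mem down w = n.*2.
  rewrite -[RHS](size_tuple w) -(count_predC (pred1 up)); congr (_ + _).
  by apply: eq_count; case.
apply/and3P; split; [apply/eqP; lia | apply/eqP; lia |].
by apply/allP => k _; exact: pre.
Qed.

Definition sigma_path : dyck n := Dyck sigma_word_dyck.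

End SigmaDyck.

Definition is_block (N k : nat) (A : {set 'I_N}) : Prop :=
  exists x : 'I_N, A = [set y : 'I_N | [exists i : 'I_k, val y == (x + i) %% N]].

Definition is_ccp (n : nat) (s : 'S_(n.*2)) : Prop :=
  forall k, 1 <= k <= n.*2 -> is_block k (prefix_set s k).

(* Main.v *)
Require Import Defs.
From mathcomp Require Import all_boot all_fingroup.
From mathcomp Require Import zify.

(** Read a Dyck path as a noncrossing perfect matching of 2n points on a circle,
    and [s] as an order in which the points are revealed.

    If every prefix of [s] is a circular block, a newly revealed point that
    closes a chord sits at an end of the block, so noncrossingness forces its
    partner to be the nearest open point of the block; hence the matching is
    recovered from the word, and injectivity suffices on a finite set.

    Conversely, suppose that two points c, e of equal parity are both revealed
    before both neighbours c + 1, c - 1 of c.  Then the matchings containing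
    {c, c+1}, {e, c-1} and {c, c-1}, {e, c+1} respectively, completed by the same
    pairs of consecutive points, have the same word.  Such c, e exist at the first
    step where the revealed set B fails to stay a block: the new point x is not
    adjacent to B, so take c = x and e in B of the parity of x.  If there is no
    such e, then B is a single point b, and the next revealed point has the
    parity of b or of x and serves as e, with c = b or c = x. *)

Set Implicit Arguments.
Unset Strict Implicit.
Unset Printing Implicit Defensive.

(** * Segment counts and the noncrossing property of tunnelings *)

Definition segment_count (c : bool) (w : seq bool) (i j : nat) : nat :=
  count_mem c (take (j - i) (drop i w)).

Lemma segment_count_cat c w i j k : i <= j <= k ->
  segment_count c w i k = segment_count c w i j + segment_count c w j k.
Proof.
move=> ijk; rewrite /segment_count.
have -> : k - i = (j - i) + (k - j) by lia.
by rewrite takeD count_cat drop_drop subnK //; lia.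
Qed.

Lemma segment_count1 c w i : i < size w ->
  segment_count c w i i.+1 = (nth down w i == c).
Proof.
by move=> iw; rewrite /segment_count subSnn (drop_nth down) //= take0 /= addn0.
Qed.

(** Counts between fixed positions of [w] add up along adjacent segments, which makes two matchings
    comparable. *)
Lemma matchingE w i j : matching w i j <->
  [/\ i < j < size w, nth down w i, ~~ nth down w j,
      segment_count up w i.+1 j = segment_count down w i.+1 j
    & forall m, i < m <= j ->
        segment_count down w i.+1 m <= segment_count up w i.+1 m].
Proof.
rewrite /matching /is_dyck eqxx andTb eqb_id -!/(segment_count _ _ _ _).
case: (boolP (i < j < size w)) => [ij|_]; last by split=> // -[].
have -> : (nth up w j == down) = ~~ nth down w j.
  by rewrite (set_nth_default down); [case: nth | lia].
have sz : size (take (j - i.+1) (drop i.+1 w)) = j - i.+1.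
  by rewrite size_takel // size_drop; lia.
split.
  case/and4P=> _ wi wj /andP[/eqP eqc /allP le]; split=> // m im.
  have := le (m - i.+1); rewrite mem_iota sz !take_takel; last by lia.
  by apply; lia.
case=> _ wi wj eqc le; apply/and4P; split=> //.
rewrite eqc eqxx; apply/allP=> m; rewrite mem_iota sz => mj.
rewrite !take_takel; try lia.
by have := le (m + i.+1); rewrite /segment_count addnK; apply; lia.
Qed.

(** In a crossing, the stretch from [i.+1] to [k] has no excess of downs and that from [i.+1] to [j]
    is balanced. Removing the up-step at [k] leaves more downs than ups between [k] and [j], which
    the matching of [k] forbids. *)
Lemma matching_noncrossing w i j k l :
  matching w i j -> matching w k l -> ~~ [&& i < k, k < j & j < l].
Proof.
move=> /matchingE[ij wi wj eqij leij] /matchingE[kl wk wl eqkl lekl].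
apply/negP=> /and3P[ik kj jl].
have := leij k; have := lekl j.+1.
have c1 c := @segment_count_cat c w i.+1 k j ltac:(lia).
have c2 c := @segment_count_cat c w k k.+1 j ltac:(lia).
have c3 c := @segment_count_cat c w k.+1 j j.+1 ltac:(lia).
have c4 c := @segment_count1 c w k ltac:(lia).
have c5 c := @segment_count1 c w j ltac:(lia).
move: eqij; rewrite !c1 !c2 !c3 !c4 !c5 wk (negbTE wj) /=; lia.
Qed.

(** For an involution, letting [a] and [b] be the left ends of two chords covers every crossing. *)
Definition noncrossing (N : nat) (t : 'I_N -> 'I_N) : Prop :=
  forall a b : 'I_N, ~~ [&& a < b, b < t a & t a < t b].

Lemma tunneling_noncrossing n (D : dyck n) : noncrossing (tunneling D).
Proof.
move=> a b; have := tunneling_spec D a; have := tunneling_spec D b.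
rewrite !permE; set a' := tunneling_fun D a; set b' := tunneling_fun D b.
move=> hb ha; apply/negP=> /and3P[ab ba' a'b'].
case/orP: ha => ha; last by have := matching_lt ha; lia.
case/orP: hb => hb; last by have := matching_lt hb; lia.
by have := matching_noncrossing ha hb; rewrite ab ba' a'b'.
Qed.

Lemma nth_dyck_tunneling n (D : dyck n) (i : 'I_(n.*2)) :
  tnth D i = (i < tunneling D i).
Proof.
rewrite (tnth_nth down) permE.
case/orP: (tunneling_spec D i) => h; have := matching_lt h.
  by rewrite (matching_up h); lia.
by rewrite (negbTE (matching_down h)); lia.
Qed.

Lemma tunneling_inj n (D D' : dyck n) : tunneling D =1 tunneling D' -> D = D'.
Proof.
move=> e; apply/val_inj/eq_from_tnth => i.
by rewrite !nth_dyck_tunneling e.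
Qed.

(** * Every noncrossing fixed-point-free involution is a tunneling *)

Section Realization.

Variables (n : nat) (t : 'I_(n.*2) -> 'I_(n.*2)).
Hypotheses (tK : involutive t) (t_neq : forall i, t i != i).

Let w : (n.*2).-tuple bool := [tuple i < t i | i < n.*2].

(** Letters are counted through their positions, on which [t] acts. *)
Lemma segment_count_card c i j : i <= j <= n.*2 ->
  segment_count c w i j =
  #|[set k : 'I_(n.*2) | (i <= k < j) && ((k < t k) == c)]|.
Proof.
move=> ij; rewrite /segment_count -sum1_count -sum1_card.
rewrite (big_nth c) size_takel ?size_drop ?size_tuple; last by lia.
transitivity (\sum_(0 <= k < n.*2 | (i <= k < j) && (nth c w k == c)) 1).
  rewrite [RHS](eq_bigl (fun k => (nth c w k == c) && (k < j) && (i <= k)));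
    last by move=> k; rewrite andbC -andbA; congr (_ && _); rewrite andbC.
  rewrite -(@big_nat_widenl _ _ _ i 0) // -(@big_nat_widen _ _ _ i j); last by lia.
  rewrite -[X in \sum_(X <= _ < j | _) _]add0n big_addn big_nat_cond [RHS]big_nat_cond.
  apply: eq_bigl => k; case: (ltnP k (j - i)) => // kij /=.
  by rewrite nth_take // nth_drop addnC.
rewrite big_mkord; apply: eq_bigl => k; rewrite inE.
by rewrite -(tnth_nth c) tnth_mktuple.
Qed.

(** Partners carry opposite letters, so [t] injects the positions of letter [c] in the segment into
    those of the other letter. *)
Lemma segment_count_le c i j : i <= j <= n.*2 ->
  (forall k : 'I_(n.*2), i <= k < j -> (k < t k) = c -> i <= t k < j) ->
  segment_count c w i j <= segment_count (~~ c) w i j.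
Proof.
move=> ij closed; rewrite !segment_count_card //.
rewrite -(card_imset _ (inv_inj tK)); apply: subset_leq_card.
apply/subsetP=> x /imsetP[k]; rewrite !inE => /andP[kij /eqP kc] ->.
rewrite tK (closed k kij kc) -kc /=; have := t_neq k; rewrite -val_eqE /=.
by case: ltngtP.
Qed.

Lemma involution_word_dyck : is_dyck n w.
Proof.
have sz := size_tuple w.
have segE c k : count_mem c (take k w) = segment_count c w 0 k.
  by rewrite /segment_count drop0 subn0.
have pre k : k <= n.*2 -> count_mem down (take k w) <= count_mem up (take k w).
  move=> kn; rewrite !segE //; apply: segment_count_le => [|x xk]; first by lia.
  by move/negbT; lia.
have suf : count_mem up w <= count_mem down w.
  rewrite -(take_size w) sz !segE //; apply: segment_count_le => [|x _ _]; first by lia.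
  by rewrite leq0n ltn_ord.
have pre' := pre _ (leqnn _); move: pre'; rewrite -{1 3}sz take_size => pre'.
have tot : count_mem up w + count_mem down w = n.*2.
  rewrite -[RHS]sz -(count_predC (pred1 up)); congr (_ + _).
  by apply: eq_count; case.
apply/and3P; split; [apply/eqP; lia | apply/eqP; lia |].
by apply/allP=> k; rewrite mem_iota sz => kn; apply: pre; lia.
Qed.

Hypothesis t_nc : noncrossing t.

(** If [t k] fell outside, the chord of [k] would cross that of [i], with left end [k] or [t k]. *)
Lemma noncrossing_nested (i k : 'I_(n.*2)) : i < k < t i -> i < t k < t i.
Proof.
move=> ik; have := t_nc i k; have := t_nc (t k) i; rewrite tK.
have n1 : val (t k) <> val i by move/val_inj=> e; move: ik; rewrite -e tK; lia.
have n2 : val (t k) <> val (t i) by move/val_inj/(inv_inj tK)=> e; subst k; lia.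
by move: n1 n2 => /=; lia.
Qed.

(** The interior of a chord is closed under [t], hence balanced. In an initial part of the interior,
    each down-step still has its partner to its left and inside. *)
Lemma involution_word_matching (i : 'I_(n.*2)) :
  i < t i -> matching w i (t i).
Proof.
move=> it; have ti := ltn_ord (t i).
have nthE (k : 'I_(n.*2)) : nth down w k = (k < t k).
  by rewrite -tnth_nth tnth_mktuple.
apply/matchingE; rewrite !nthE tK size_tuple; split=> //; try lia.
  apply/eqP; rewrite eqn_leq; apply/andP; split.
    by apply: segment_count_le => [|k /noncrossing_nested]; lia.
  by apply: segment_count_le => [|k /noncrossing_nested]; lia.
move=> m im; apply: segment_count_le => [|k km /negbT]; first by lia.
by have := @noncrossing_nested i k; lia.
Qed.

Lemma noncrossing_is_tunneling : exists D : dyck n, tunneling D =1 t.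
Proof.
exists (Dyck involution_word_dyck) => i; rewrite permE; apply/val_inj.
apply: (matching_uniq (tunneling_spec _ i)) => /=.
have := t_neq i; rewrite -val_eqE /=; case: ltngtP => // h _.
  by have := @involution_word_matching (t i); rewrite tK => ->; rewrite ?orbT.
by rewrite involution_word_matching.
Qed.

End Realization.

(** * Rotations of the circle and blocks in rotated coordinates *)

Section Rotation.

Variable N : nat.
Implicit Types c x y : 'I_N.

Definition rotate_fun c x : 'I_N :=
  Ordinal (ltn_pmod (c + x) (leq_ltn_trans (leq0n c) (ltn_ord c))).

(** Both summands are below [N], so at most one wrap-around occurs; this linear form lets [lia]
    reason about the circle. *)
Lemma rotate_funE c x : let y := nat_of_ord (rotate_fun c x) in
  c + x < N /\ y = c + x \/ N <= c + x /\ y + N = c + x.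
Proof.
rewrite /=; case: ltnP => h; [left|right]; split=> //.
  by rewrite modn_small.
have cN := ltn_ord c; have xN := ltn_ord x.
by rewrite -[in LHS](subnK h) modnDr modn_small ?subnK //; lia.
Qed.

Lemma rotate_fun_inj c : injective (rotate_fun c).
Proof.
move=> x y /(congr1 (@nat_of_ord N)) e; apply/ord_inj.
have := rotate_funE c x; have := rotate_funE c y; rewrite -e /=.
by have := ltn_ord x; have := ltn_ord y; lia.
Qed.

Definition rotation c : 'S_N := perm (@rotate_fun_inj c).

Lemma rotationE c x : let y := nat_of_ord (rotation c x) in
  c + x < N /\ y = c + x \/ N <= c + x /\ y + N = c + x.
Proof. by rewrite permE; exact: rotate_funE. Qed.

Lemma rotation_surj c y : exists x, y = rotation c x.
Proof. by exists ((rotation c)^-1 y)%g; rewrite permKV. Qed.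

(** Rotation keeps the cyclic order of four endpoints but may change which comes first; hence the
    four instances of the hypothesis. *)
Lemma noncrossing_rotation c (t f : 'I_N -> 'I_N) :
  involutive t -> involutive f -> (forall x, t (rotation c x) = rotation c (f x)) ->
  noncrossing t <-> noncrossing f.
Proof.
move=> tK fK tf; split=> nc a b.
  have e1 := rotationE c a; have e2 := rotationE c b.
  have e3 := rotationE c (f a); have e4 := rotationE c (f b).
  have := nc (rotation c a) (rotation c b).
  have := nc (rotation c b) (rotation c (f a)).
  have := nc (rotation c (f a)) (rotation c (f b)).
  have := nc (rotation c (f b)) (rotation c a).
  rewrite !tf !fK.
  have := ltn_ord a; have := ltn_ord b; have := ltn_ord (f a).
  have := ltn_ord (f b).
  move: e1 e2 e3 e4 => /=; lia.
have [x ->] := rotation_surj c a; have [y ->] := rotation_surj c b.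
have e1 := rotationE c x; have e2 := rotationE c y.
have e3 := rotationE c (f x); have e4 := rotationE c (f y).
have := nc x y; have := nc y (f x); have := nc (f x) (f y); have := nc (f y) x.
rewrite !tf !fK.
have := ltn_ord x; have := ltn_ord y; have := ltn_ord (f x).
have := ltn_ord (f y).
move: e1 e2 e3 e4 => /=; lia.
Qed.

(** Measured from its starting point, a block is an initial segment. *)
Lemma block_rotation k (A : {set 'I_N}) c : k <= N ->
  A = [set y : 'I_N | [exists i : 'I_k, val y == (c + i) %% N]] <->
  forall x, (rotation c x \in A) = (x < k).
Proof.
move=> kN.
have mem_block x :
    [exists i : 'I_k, val (rotation c x) == (c + i) %% N] = (x < k).
  apply/existsP/idP => [[i /eqP e]|xk].
    have iN : i < N by have := ltn_ord i; lia.
    suff -> : x = Ordinal iN by exact: ltn_ord i.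
    by apply: (@perm_inj _ (rotation c)); apply/val_inj; rewrite e permE.
  by exists (Ordinal xk); rewrite permE.
split=> [-> x|h]; first by rewrite inE mem_block.
by apply/setP=> y; have [x ->] := rotation_surj c y; rewrite h inE mem_block.
Qed.

End Rotation.

(** * Revealing times *)

Lemma mem_prefix_set n (s : 'S_(n.*2)) k x : (s x \in prefix_set s k) = (x < k).
Proof. by rewrite mem_imset ?inE //; exact: perm_inj. Qed.

(** With [s^-1] read as the time at which a point is revealed, the letter compares the times of two
    partners. *)
Lemma tnth_sigma_word n (s : 'S_(n.*2)) (D : dyck n) k :
  tnth (sigma_word s D) k = (k < (s^-1)%g (tunneling D (s k))).
Proof.
rewrite tnth_mktuple -{1}(permKV s (tunneling D (s k))) mem_prefix_set.
by rewrite ltnS -ltnNge.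
Qed.

Lemma mem_prefix_setS n (s : 'S_(n.*2)) (k c m x : 'I_(n.*2)) :
  s k = rotation c m ->
  (rotation c x \in prefix_set s k.+1) =
    (rotation c x \in prefix_set s k) || (x == m).
Proof.
move=> sk; rewrite -(inj_eq (@perm_inj _ (rotation c))) -sk.
rewrite -(permKV s (rotation c x)) !mem_prefix_set (inj_eq perm_inj).
by rewrite ltnS leq_eqVlt orbC -val_eqE.
Qed.

(** * Circularly-connected permutations give injective maps *)

Section Injectivity.

Variables (n : nat) (s : 'S_(n.*2)).
Hypothesis s_ccp : is_ccp s.

(** In the larger block the new point has a neighbour, which belongs to the old block; so the new
    point extends the old block at one of its ends. *)
Lemma ccp_step (k : 'I_(n.*2)) : 0 < k ->
  exists c m, [/\ forall x, (rotation c x \in prefix_set s k) = (x < k),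
    s k = rotation c m & m = k :> nat \/ m.+1 = n.*2 :> nat].
Proof.
move=> k0; have kN := ltn_ord k.
have [c] := @s_ccp k ltac:(lia); rewrite block_rotation => [hc|]; last by lia.
have [d] := @s_ccp k.+1 ltac:(lia); rewrite block_rotation => // hd.
have [m sk] := rotation_surj c (s k); exists c, m; split=> //.
have hcS x : (rotation c x \in prefix_set s k.+1) = (x < k) || (x == m).
  by rewrite (mem_prefix_setS _ sk) hc.
have km : k <= m by rewrite leqNgt -hc -sk mem_prefix_set ltnn.
have [p ep] := rotation_surj d (rotation c m).
have pk : p < k.+1 by rewrite -hd -ep -sk mem_prefix_set.
have mN := ltn_ord m.
(* Here [q] is next to [p] inside the larger block, which has at least two points because
   [0 < k]. *)
have [q [qp qk]] : exists q : nat, (q = p.+1 \/ q.+1 = p) /\ q < k.+1.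
  by case: (ltnP p k) => pk'; [exists p.+1 | exists p.-1]; lia.
have qN : q < n.*2 by lia.
have [u eu] := rotation_surj c (rotation d (Ordinal qN)).
have : (u < k) || (u == m) by rewrite -hcS -eu hd.
have := rotationE d (Ordinal qN); have := rotationE c u.
have := rotationE d p; have := rotationE c m; rewrite -eu -ep -val_eqE /=.
have := ltn_ord u; lia.
Qed.

(** If [y] and [y'] differed, one of [t] and [t'] would join [m] to the farther of them and the
    nearer one to a point outside the block. As [m] sits at an end of the block, these two chords
    would cross. *)
Lemma closing_partner_unique (t t' : 'I_(n.*2) -> 'I_(n.*2)) k
    (c m y y' z z' : 'I_(n.*2)) :
  involutive t -> involutive t' -> noncrossing t -> noncrossing t' ->
  m = k :> nat \/ m.+1 = n.*2 -> k <= m -> y < k -> y' < k -> k <= z -> k <= z' ->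
  t (rotation c m) = rotation c y -> t (rotation c y') = rotation c z ->
  t' (rotation c m) = rotation c y' -> t' (rotation c y) = rotation c z' ->
  y = y'.
Proof.
move=> tK tK' nc nc' mE km yk y'k kz kz' tm ty' t'm t'y.
pose conj u x := ((rotation c)^-1 (u (rotation c x)))%g.
have conjE u x : u (rotation c x) = rotation c (conj u x) by rewrite /conj permKV.
have conjK u : involutive u -> involutive (conj u).
  by move=> uK x; rewrite /conj permKV uK permK.
move/(noncrossing_rotation tK (conjK _ tK) (conjE t)): nc => nc.
move/(noncrossing_rotation tK' (conjK _ tK') (conjE t')): nc' => nc'.
have conj_val u x v : u (rotation c x) = rotation c v -> conj u x = v.
  by rewrite /conj => ->; rewrite permK.
move/conj_val: tm => fm; move/conj_val: ty' => fy'.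
move/conj_val: t'm => f'm; move/conj_val: t'y => f'y.
have fy : conj t y = m by rewrite -fm conjK.
have f'y' : conj t' y' = m by rewrite -f'm conjK.
apply/eqP/negPn/negP => yy'.
(* If [z] were [m], then [m] would have both [y] and [y'] as partners. *)
have zm : z != m by apply: contra yy' => /eqP e; rewrite -fm -e -fy' conjK.
have z'm : z' != m by apply: contra yy' => /eqP e; rewrite -f'm -e -f'y conjK.
have := nc y y'; have := nc y' y; have := nc' y y'; have := nc' y' y.
rewrite fy fy' f'y f'y'; move: zm z'm yy'; rewrite -!val_eqE /=.
have := ltn_ord z; have := ltn_ord z'; lia.
Qed.

Lemma ccp_sigma_path_inj : injective (sigma_path s).
Proof.
move=> D D' /(congr1 (fun E => dyck_word E)) eqw.
(* [r E] is the tunneling of [E] transported from points to revealing times. *)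
pose r E k := (s^-1)%g (tunneling E (s k)).
have rK E : involutive (r E) by move=> k; rewrite /r permKV tunnelingK permK.
have rE (k : 'I_(n.*2)) : (k < r D k) = (k < r D' k).
  by rewrite -!tnth_sigma_word -[sigma_word s D]/(dyck_word (sigma_path s D)) eqw.
have r_neq E k : r E k != k.
  apply/eqP=> e; have /eqP := tunneling_neq E (s k); apply.
  by rewrite -{2}e /r permKV.
(* Each pair has a later member, so agreement at closing times is enough; it is proved by strong
   induction on the time. *)
suff down_eq (k : 'I_(n.*2)) : r D k < k -> r D k = r D' k.
  apply: tunneling_inj => x; have -> : x = s ((s^-1)%g x) by rewrite permKV.
  apply: (@perm_inj _ (s^-1)%g); rewrite -!/(r _ _).
  move: ((s^-1)%g x) => {x} k; have := r_neq D k; rewrite -val_eqE /=.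
  case: ltngtP => // h _; first exact: down_eq.
  by have := down_eq (r D k); rewrite rK => /(_ h) e; rewrite {2}e rK.
have [m] := ubnP k; elim: m k => // m IH k km rk.
set i := r D k; set j := r D' k.
have down_iff l : (r D l < l) = (r D' l < l).
  have := rE l; have := r_neq D l; have := r_neq D' l; rewrite -!val_eqE /=; lia.
(* A pair revealed entirely before [k] closes before [k], so the induction hypothesis makes it
   common to both paths. *)
have early_eq (l p : 'I_(n.*2)) : l < k -> p < k -> (r D l = p <-> r D' l = p).
  wlog lp : l p / p < l => [W lk pk|lk pk].
    have swap E : r E l = p <-> r E p = l by split=> <-; rewrite rK.
    case: (ltngtP p l) => [/W|/W h|/ord_inj e]; first by apply.
      by rewrite !swap; apply: h.
    by subst p; split=> /eqP; rewrite (negbTE (r_neq _ _)).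
  split=> e; first by rewrite -e; symmetry; apply: IH; [lia | rewrite e].
  by rewrite -e; apply: IH; [lia | rewrite down_iff e].
have jk : j < k by rewrite -down_iff.
have k0 : 0 < k by lia.
have [c [x [hc sk xE]]] := ccp_step k0.
have [y sy] := rotation_surj c (s i); have [y' sy'] := rotation_surj c (s j).
(* Both [z] and [z'] lie outside the block: a partner revealed before [k] would be shared by [D] and
   [D'], but [D'] matches [s j] with [s k], and [D] matches [s i] with [s k]. *)
have [z sz] := rotation_surj c (tunneling D (s j)).
have [z' sz'] := rotation_surj c (tunneling D' (s i)).
have prefixE E l u : tunneling E (s l) = rotation c u -> (u < k) = (r E l < k).
  by move=> e; rewrite -hc -e -(permKV s (tunneling E _)) mem_prefix_set.
suff yy' : y = y' by apply: (@perm_inj _ s); rewrite sy sy' yy'.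
apply: (closing_partner_unique (c := c) (z := z) (z' := z')
  (tunnelingK D) (tunnelingK D')
  (tunneling_noncrossing D) (tunneling_noncrossing D') xE).
- by rewrite leqNgt -hc -sk mem_prefix_set ltnn.
- by rewrite -hc -sy mem_prefix_set.
- by rewrite -hc -sy' mem_prefix_set.
- rewrite leqNgt (prefixE _ _ _ sz); apply/negP=> h.
  have [/(_ erefl)] := @early_eq j _ jk h; rewrite /j rK => e _.
  by move: h; rewrite -/j -e ltnn.
- rewrite leqNgt (prefixE _ _ _ sz'); apply/negP=> h.
  have [_ /(_ erefl)] := @early_eq i _ rk h; rewrite /i rK => e.
  by move: h; rewrite -/i -e ltnn.
- by rewrite -sk -sy /i /r permKV.
- by rewrite -sy' sz.
- by rewrite -sk -sy' /j /r permKV.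
- by rewrite -sy sz'.
Qed.

End Injectivity.

(** * Pairs of Dyck paths with the same word *)

Lemma rotationA N (c m x : 'I_N) :
  rotation (rotation c m) x = rotation c (rotation m x).
Proof.
apply/ord_inj; have := rotationE (rotation c m) x; have := rotationE c m.
have := rotationE c (rotation m x); have := rotationE m x => /=.
have := ltn_ord (rotation c (rotation m x)).
have := ltn_ord (rotation (rotation c m) x).
by have := ltn_ord c; have := ltn_ord m; have := ltn_ord x; lia.
Qed.

(** Noncrossing is invariant under rotation, so a pairing written in coordinates based at [c] is
    still realized by a Dyck path. *)
Lemma rotated_tunneling n (c : 'I_(n.*2)) (f : 'I_(n.*2) -> 'I_(n.*2)) :
  involutive f -> (forall x, f x != x) -> noncrossing f ->
  exists D : dyck n, forall x, tunneling D (rotation c x) = rotation c (f x).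
Proof.
move=> fK f_neq f_nc; pose t x := rotation c (f ((rotation c)^-1 x)%g).
have tE x : t (rotation c x) = rotation c (f x) by rewrite /t permK.
have tK : involutive t by move=> x; rewrite /t permK fK permKV.
have t_neq x : t x != x.
  by have [y ->] := rotation_surj c x; rewrite tE (inj_eq perm_inj).
have [D DE] := noncrossing_is_tunneling tK t_neq
  (iffRL (noncrossing_rotation tK fK tE) f_nc).
by exists D => x; rewrite DE tE.
Qed.

Section Collision.

Variables (n : nat) (e : 'I_(n.*2)).
Hypotheses (e_even : ~~ odd e) (e_gt0 : 0 < e).

Local Notation N := (n.*2).

(* The two pairings agree on pairs of consecutive points and pair
   the points 0, 1, e, N - 1 as {01, e(N-1)} and {0(N-1), 1e} respectively. *)
Definition pairing1_fun (x : nat) : nat :=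
  if x < e then if odd x then x.-1 else x.+1
  else if x == e then N.-1 else if x == N.-1 then nat_of_ord e
  else if odd x then x.+1 else x.-1.

Definition pairing2_fun (x : nat) : nat :=
  if x == 0 then N.-1 else if x == N.-1 then 0
  else if x == 1 then nat_of_ord e else if x == e then 1
  else if (x < e) (+) odd x then x.+1 else x.-1.

(** Linear cases with parities, suited to [lia]; since [e] is even, consecutive pairs never straddle
    [e]. *)
Lemma pairing1_fun_spec (x : 'I_N) : let y := pairing1_fun x in
  [\/ x < e /\ (odd x /\ y.+1 = x \/ ~~ odd x /\ y = x.+1),
      x = e :> nat /\ y.+1 = N, x.+1 = N /\ y = e
    | e < x /\ x.+1 < N /\ (odd x /\ y = x.+1 \/ ~~ odd x /\ y.+1 = x)].
Proof.
have xN := ltn_ord x; have eN := ltn_ord e; rewrite /pairing1_fun /=.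
case: (ltngtP x e) => xe.
- by apply: Or41; case: ifP => ?; lia.
- case: eqP => x1; first by apply: Or43; lia.
  by apply: Or44; case: ifP => ?; lia.
- by apply: Or42; lia.
Qed.

Lemma pairing2_fun_spec (x : 'I_N) : let y := pairing2_fun x in
  [\/ x = 0 :> nat /\ y.+1 = N \/ x.+1 = N /\ y = 0,
      x = 1 :> nat /\ y = e \/ x = e :> nat /\ y = 1,
      1 < x < e /\ (odd x /\ y.+1 = x \/ ~~ odd x /\ y = x.+1)
    | e < x /\ x.+1 < N /\ (odd x /\ y = x.+1 \/ ~~ odd x /\ y.+1 = x)].
Proof.
have xN := ltn_ord x; have eN := ltn_ord e; rewrite /pairing2_fun /=.
case: eqP => x0; first by apply: Or41; lia.
case: eqP => x1; first by apply: Or41; lia.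
case: eqP => x2; first by apply: Or42; lia.
case: eqP => x3; first by apply: Or42; lia.
by case: ltnP => xe /=; [apply: Or43 | apply: Or44]; case: (boolP (odd x)) => /= ?; lia.
Qed.

Lemma pairing1_fun_lt (x : 'I_N) : pairing1_fun x < N.
Proof. by have := ltn_ord x; have := ltn_ord e; case: (pairing1_fun_spec x); lia. Qed.

Lemma pairing2_fun_lt (x : 'I_N) : pairing2_fun x < N.
Proof. by have := ltn_ord x; have := ltn_ord e; case: (pairing2_fun_spec x); lia. Qed.

Definition pairing1 x : 'I_N := Ordinal (pairing1_fun_lt x).
Definition pairing2 x : 'I_N := Ordinal (pairing2_fun_lt x).

Lemma pairing1K : involutive pairing1.
Proof.
move=> x; apply/ord_inj; have := ltn_ord x; have := ltn_ord e.
have := pairing1_fun_spec (pairing1 x); have := pairing1_fun_spec x => /=.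
by case=> ?; case=> ?; lia.
Qed.

Lemma pairing2K : involutive pairing2.
Proof.
move=> x; apply/ord_inj; have := ltn_ord x; have := ltn_ord e.
have := pairing2_fun_spec (pairing2 x); have := pairing2_fun_spec x => /=.
by case=> ?; case=> ?; lia.
Qed.

Lemma pairing1_neq x : pairing1 x != x.
Proof.
have := ltn_ord x; have := ltn_ord e; rewrite -val_eqE /=.
by case: (pairing1_fun_spec x); lia.
Qed.

Lemma pairing2_neq x : pairing2 x != x.
Proof.
have := ltn_ord x; have := ltn_ord e; rewrite -val_eqE /=.
by case: (pairing2_fun_spec x); lia.
Qed.

Lemma pairing1_noncrossing : noncrossing pairing1.
Proof.
move=> a b; have := ltn_ord a; have := ltn_ord b; have := ltn_ord e => /=.
by case: (pairing1_fun_spec a) => ?; case: (pairing1_fun_spec b) => ?; lia.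
Qed.

Lemma pairing2_noncrossing : noncrossing pairing2.
Proof.
move=> a b; have := ltn_ord a; have := ltn_ord b; have := ltn_ord e => /=.
by case: (pairing2_fun_spec a) => ?; case: (pairing2_fun_spec b) => ?; lia.
Qed.

(** Where the pairings differ, both join one of [0], [e] to one of [1], [N - 1]. If the former two
    are revealed before the latter two, the letters cannot tell the pairings apart. *)
Lemma pairing_eq_or_alternate (x : 'I_N) :
  [\/ pairing1 x = pairing2 x,
      (x = 0 :> nat \/ x = e) /\
        forall y, y = pairing1 x \/ y = pairing2 x -> y = 1 :> nat \/ y.+1 = N
    | (x = 1 :> nat \/ x.+1 = N) /\
        forall y, y = pairing1 x \/ y = pairing2 x -> y = 0 :> nat \/ y = e].
Proof.
have xN := ltn_ord x; have eN := ltn_ord e.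
have ordE (y z : 'I_N) : y = z <-> y = z :> nat.
  by split=> [->|/ord_inj].
have h1 := pairing1_fun_spec x; have h2 := pairing2_fun_spec x.
have [x0|x0] := boolP ((x == 0 :> nat) || (x == e)).
  apply: Or32; split; first by move: x0; rewrite -val_eqE /= ordE; lia.
  move: x0; rewrite -val_eqE /= => x0 y; rewrite !ordE /=.
  by case: h1 => ?; case: h2 => ?; lia.
have [x1|x1] := boolP ((x == 1 :> nat) || (x.+1 == N)).
  apply: Or33; split; first by lia.
  move=> y; rewrite !ordE /=.
  by case: h1 => ?; case: h2 => ?; lia.
apply: Or31; apply/ordE; move: x0; rewrite -val_eqE /= => x0.
by case: h1 => ?; case: h2 => ?; lia.
Qed.

Lemma sigma_path_collision (s : 'S_N) (c : 'I_N) :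
  (forall p q : 'I_N, p = 0 :> nat \/ p = e -> q = 1 :> nat \/ q.+1 = N ->
     (s^-1)%g (rotation c p) < (s^-1)%g (rotation c q)) ->
  ~ injective (sigma_path s).
Proof.
move=> early inj.
have [D1 D1E] := rotated_tunneling c pairing1K pairing1_neq pairing1_noncrossing.
have [D2 D2E] := rotated_tunneling c pairing2K pairing2_neq pairing2_noncrossing.
have eqD : D1 = D2.
  apply: inj; apply/val_inj/eq_from_tnth => k; rewrite !tnth_sigma_word.
  have [x sk] := rotation_surj c (s k); rewrite sk D1E D2E.
  have -> : k = (s^-1)%g (rotation c x) by rewrite -sk permK.
  case: (pairing_eq_or_alternate x) => [-> //|[x0 h]|[x0 h]].
    by rewrite !early //; apply: h; auto.
  have late y : y = pairing1 x \/ y = pairing2 x ->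
      ((s^-1)%g (rotation c x) < (s^-1)%g (rotation c y)) = false.
    by move=> /h y0; apply/negbTE; rewrite -leqNgt ltnW // early.
  by rewrite !late; auto.
have N0 : 0 < N by have := ltn_ord e; lia.
(* The pairings differ at [0], whose partner is [1] in the first and [N - 1] in the second. *)
have := D1E (Ordinal N0); rewrite eqD D2E => /perm_inj /(congr1 (@nat_of_ord N)).
have := ltn_ord e.
by case: (pairing1_fun_spec (Ordinal N0)) => /= ?; case: (pairing2_fun_spec (Ordinal N0)) => /= ?; lia.
Qed.

End Collision.

(** Measured from [m], the point [e] has a nonzero even coordinate, the circle having even length.
    The four cases for [u] express circular adjacency to [m], wrap-around included. *)
Lemma early_same_parity_collision n (s : 'S_(n.*2)) (c m e : 'I_(n.*2)) k :
  m != e -> odd m = odd e ->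
  rotation c m \in prefix_set s k -> rotation c e \in prefix_set s k ->
  (forall u : 'I_(n.*2),
     [\/ u = m.+1 :> nat, u.+1 = m :> nat, m = 0 :> nat /\ u.+1 = n.*2
       | m.+1 = n.*2 /\ u = 0 :> nat] -> rotation c u \notin prefix_set s k) ->
  ~ injective (sigma_path s).
Proof.
move=> me odd_me m_early e_early neighbours_late.
have [e' ee'] := rotation_surj m e; have e'E := rotationE m e'.
have mN := ltn_ord m; have eN := ltn_ord e; have e'N := ltn_ord e'.
move: e'E; rewrite -ee' /= => e'E; move: me; rewrite -val_eqE /= => me.
apply: (@sigma_path_collision n e' _ _ s (rotation c m)); try lia.
move=> p q p0 q1; rewrite !rotationA.
have pE := rotationE m p; have qE := rotationE m q; move: pE qE => /= pE qE.
have p_early : rotation c (rotation m p) \in prefix_set s k.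
  case: p0 => [p0|->]; last by rewrite -ee'.
  by rewrite (_ : rotation m p = m) //; apply/ord_inj; lia.
have q_late : rotation c (rotation m q) \notin prefix_set s k.
  apply: neighbours_late; have qN := ltn_ord q.
  case: pE qE => [] _ [] [h1 h2]; case: q1 => q1;
    first [by apply: Or41; lia | by apply: Or42; lia
          | by apply: Or43; lia | by apply: Or44; lia].
move: p_early q_late.
rewrite -{1}(permKV s (rotation c (rotation m p))) mem_prefix_set.
rewrite -{1}(permKV s (rotation c (rotation m q))) mem_prefix_set.
by lia.
Qed.

(** * Injectivity forces every prefix to be a block *)

Lemma sigma_path_inj_ccp n (s : 'S_(n.*2)) : injective (sigma_path s) -> is_ccp s.
Proof.
move=> inj; elim=> // k IH /andP[_ kN].
case: (posnP k) => [k0|k_gt0].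
  subst k; pose z := Ordinal kN; exists (s z); apply/block_rotation => // x.
  have sz : s z = rotation (s z) z.
    by apply/ord_inj; have := rotationE (s z) z; have := ltn_ord (s z) => /=; lia.
  rewrite (mem_prefix_setS x sz) -{1}(permKV s (rotation _ x)) mem_prefix_set.
  by rewrite ltn0 -val_eqE /=; lia.
have [c] := IH ltac:(lia); rewrite block_rotation => [hc|]; last by lia.
pose k' := Ordinal kN; have [m sk] := rotation_surj c (s k').
have hcS x : (rotation c x \in prefix_set s k.+1) = (x < k) || (x == m).
  by rewrite (mem_prefix_setS (k := k') x sk) hc.
have mN := ltn_ord m.
have km : k <= m by rewrite leqNgt -hc -sk mem_prefix_set ltnn.
(* A new point just after the block keeps its start; one just before it, at coordinate [n.*2 - 1],
   becomes the new start. *)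
have [mk|mk] := eqVneq (val m) k.
  exists c; apply/block_rotation => // x; rewrite hcS -val_eqE /=.
  by move: mk => /=; lia.
have [mN1|mN1] := eqVneq m.+1 n.*2.
  exists (rotation c m); apply/block_rotation => // x.
  rewrite rotationA hcS -val_eqE /=; have := rotationE m x => /=.
  by have := ltn_ord x; lia.
exfalso.
move: mk => /= mk.
(* Read as a number, [odd m] is the smallest coordinate with the parity of [m]; it lies in the block
   unless [k = 1] and [m] is odd. *)
have [i_lt|i_ge] := ltnP (odd m) k.
  have iN : odd m < n.*2 by lia.
  apply: (@early_same_parity_collision n s c m (Ordinal iN) k.+1) inj.
  - by rewrite -val_eqE /=; lia.
  - by rewrite /=; lia.
  - by rewrite hcS eqxx orbT.
  - by rewrite hcS i_lt.
  - by move=> u u_adj; rewrite hcS -val_eqE /=; have := ltn_ord u; case: u_adj; lia.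
have k1 : k = 1 by lia.
subst k; have N2 : 2 < n.*2 by lia.
(* The third revealed point [l] shares its parity with [m] or with [0]. The neighbours of that point
   have the other parity, so [l] is not among them. *)
have [l sl] := rotation_surj c (s (Ordinal N2)).
have hc3 x : (rotation c x \in prefix_set s 3) = (x < 1) || (x == m) || (x == l).
  by rewrite (mem_prefix_setS (k := Ordinal N2) x sl) hcS.
have l_late : ~~ ((l < 1) || (l == m)) by rewrite -hcS -sl mem_prefix_set.
have lN := ltn_ord l; move: l_late; rewrite -val_eqE /= => l_late.
have [l_odd|l_even] := boolP (odd l).
  apply: (@early_same_parity_collision n s c m l 3) inj.
  - by rewrite -val_eqE /=; lia.
  - by lia.
  - by rewrite hc3 eqxx orbT.
  - by rewrite hc3 eqxx orbT.
  - move=> u u_adj; rewrite hc3 -!val_eqE /=; have := ltn_ord u.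
    by case: u_adj; lia.
have N0 : 0 < n.*2 by lia.
apply: (@early_same_parity_collision n s c (Ordinal N0) l 3) inj.
- by rewrite -val_eqE /=; lia.
- by rewrite /=; lia.
- by rewrite hc3.
- by rewrite hc3 eqxx orbT.
- move=> u u_adj; rewrite hc3 -!val_eqE /=; have := ltn_ord u.
  by case: u_adj => /=; lia.
Qed.

Theorem theorem6 (n : nat) (hn : 1 <= n) (s : 'S_(n.*2)) :
  bijective (sigma_path s) <-> is_ccp s.
Proof.
split; first by move/bij_inj; exact: sigma_path_inj_ccp.
by move/ccp_sigma_path_inj/injF_bij.
Qed.
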